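(* Let $n,k,m\ge 0$ be integers with $m\le n+k$, and let $\mathcal{P}$ be the two-row skew shape $(n+k,m)/(k)$. Let $\mathrm{Int}$ be the poset with element set $\{(a,b)\in\mathbb{Z}^2: 0\le a\le n-1,\ 0\le b\le m-1,\ b\le a+k-1\}$ and order $(a,b)\le(a',b')$ iff $a\le a'$ and $b\ge b'$. For each integer $t$ let $c_t$ be the product of the toggles $t_p$ (acting on $J(\mathrm{Int})$) over all $p=(a,b)\in\mathrm{Int}$ with $a+b=t$, and let $\mathrm{pro}=c_{n+m-2}\circ\cdots\circ c_1\circ c_0$ (so $c_0$ is applied first). Then there is a bijection $\Phi$ from $J(\mathrm{Int})$ to the set of standard Young tableaux of shape $\mathcal{P}$ such that $\Phi\circ\mathrm{pro}=\mathrm{Pro}\circ\Phi$, where $\mathrm{Pro}$ is Schützenberger promotion on standard Young tableaux.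
   Context: $J(P)$ denotes the set of order ideals of a poset $P$. For $p\in P$ the toggle $t_p:J(P)\to J(P)$ is: $t_p(I)=I\cup\{p\}$ if $p\notin I$ and all $p'<p$ lie in $I$; $t_p(I)=I\setminus\{p\}$ if $p\in I$ and no $p'>p$ lies in $I$; $t_p(I)=I$ otherwise. Elements with the same value of $a+b$ are pairwise non-covering, so $c_t$ is well defined. The skew shape $(n+k,m)/(k)$ has first row consisting of the cells in columns $k+1,\dots,n+k$ and second row consisting of the cells in columns $1,\dots,m$; a standard Young tableau of this shape is a bijective labeling of its $N=n+m$ cells by $1,\dots,N$ increasing along rows (left to right) and down columns. For $1\le i\le N-1$, $\rho_i$ swaps the labels $i$ and $i+1$ unless the two cells carrying them are adjacent (horizontally or vertically), in which case it does nothing; promotion is $\mathrm{Pro}=\rho_{N-1}\circ\cdots\circ\rho_2\circ\rho_1$ (so $\rho_1$ is applied first). (The poset $\mathrm{Int}$ is the poset of bounded faces of the planar Hasse diagram of $J(\mathcal{P})$, with covers between adjacent faces, as described in the paper.) *)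

(* Defs.v *)
From HB Require Import structures.
From mathcomp Require Import all_boot all_order.
From mathcomp Require Import zify.

Set Implicit Arguments.
Unset Strict Implicit.
Unset Printing Implicit Defensive.

Import Order.TTheory.

Definition is_ideal (d : Order.disp_t) (P : finPOrderType d) (I : {set P}) : bool :=
  [forall x in I, forall y : P, (y <= x)%O ==> (y \in I)].

Record ideal (d : Order.disp_t) (P : finPOrderType d) :=
  Ideal { ideal_set :> {set P}; _ : is_ideal ideal_set }.
HB.instance Definition _ (d : Order.disp_t) (P : finPOrderType d) :=
  [isSub for @ideal_set d P].
HB.instance Definition _ (d : Order.disp_t) (P : finPOrderType d) :=
  [Finite of ideal P by <:].

Definition toggle_set (d : Order.disp_t) (P : finPOrderType d)
    (p : P) (I : {set P}) : {set P} :=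
  if (p \notin I) && [forall q : P, (q < p)%O ==> (q \in I)] then p |: I
  else if (p \in I) && [forall q : P, (p < q)%O ==> (q \notin I)] then I :\ p
  else I.

Lemma toggle_set_ideal (d : Order.disp_t) (P : finPOrderType d)
  (p : P) (I : ideal P) : is_ideal (toggle_set p I).
Proof.
case: I => I idI /=; rewrite /toggle_set.
have dI x y : x \in I -> (y <= x)%O -> y \in I.
  move=> xI le_yx; move/forall_inP: idI => /(_ x xI) /forallP /(_ y) /implyP.
  exact.
case: ifP => [/andP[_ /forallP lo]|_]; last case: ifP => [/andP[_ /forallP up]|//].
- apply/forall_inP => x /setU1P xI; apply/forallP => y; apply/implyP => le_yx.
  apply/setU1P; case: xI => [ex|xI]; last by right; apply: dI le_yx.
  move: le_yx; rewrite ex le_eqVlt => /predU1P[->|lt_yp]; first by left.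
  by right; apply: (implyP (lo y)).
- apply/forall_inP => x /setD1P[/eqP x'p xI].
  apply/forallP => y; apply/implyP => le_yx.
  apply/setD1P; split; last exact: dI le_yx.
  apply/eqP => ey; move: le_yx; rewrite ey le_eqVlt => /predU1P[ex|lt_px].
    by case: x'p.
  by have := implyP (up x) lt_px; rewrite xI.
Qed.

Definition toggle (d : Order.disp_t) (P : finPOrderType d)
    (p : P) (I : ideal P) : ideal P :=
  Ideal (toggle_set_ideal p I).

(* The condition b <= a + k - 1 on integers is b < a + k on naturals, which
   avoids the truncated subtraction. *)
Record Int (n k m : nat) :=
  IntElt { int_pair : 'I_n * 'I_m; _ : int_pair.2 < int_pair.1 + k }.
HB.instance Definition _ (n k m : nat) := [isSub for @int_pair n k m].
HB.instance Definition _ (n k m : nat) := [Finite of Int n k m by <:].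

Definition int_a (n k m : nat) (p : Int n k m) : nat := (int_pair p).1.
Definition int_b (n k m : nat) (p : Int n k m) : nat := (int_pair p).2.

Definition int_le (n k m : nat) (p q : Int n k m) : bool :=
  (int_a p <= int_a q) && (int_b q <= int_b p).

Lemma int_le_refl (n k m : nat) : reflexive (@int_le n k m).
Proof. by move=> p; rewrite /int_le !leqnn. Qed.

Lemma int_le_anti (n k m : nat) : antisymmetric (@int_le n k m).
Proof.
move=> p q; rewrite /int_le /int_a /int_b => h; apply: val_inj => /=.
case: (int_pair p) (int_pair q) h => [a b] [a' b'] /= h.
by congr (_, _); apply: val_inj => /=; lia.
Qed.

Lemma int_le_trans (n k m : nat) : transitive (@int_le n k m).
Proof. by move=> q p r; rewrite /int_le; lia. Qed.

HB.instance Definition _ (n k m : nat) :=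
  Order.Le_isPOrder.Build (Order.Disp tt tt) (Int n k m)
    (@int_le_refl n k m) (@int_le_anti n k m) (@int_le_trans n k m).

(* The toggles composed here commute pairwise, so the enumeration order used
   by the fold is immaterial. *)
Definition pro_c (n k m t : nat) (I : ideal (Int n k m)) : ideal (Int n k m) :=
  foldr (@toggle _ (Int n k m)) I
    [seq p <- enum {: Int n k m} | int_a p + int_b p == t].

Definition pro (n k m : nat) (I : ideal (Int n k m)) : ideal (Int n k m) :=
  foldl (fun J t => pro_c t J) I (iota 0 (n + m).-1).

(* Cells of the skew shape la / mu, as pairs (row, column) numbered from 0; the
   column bound [head 0 la] loses nothing when la is a partition. *)
Record skew_cell (la mu : seq nat) :=
  SkewCell { cell_pair : 'I_(size la) * 'I_(head 0 la);
             _ : nth 0 mu cell_pair.1 <= cell_pair.2 < nth 0 la cell_pair.1 }.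
HB.instance Definition _ (la mu : seq nat) := [isSub for @cell_pair la mu].
HB.instance Definition _ (la mu : seq nat) := [Finite of skew_cell la mu by <:].

Definition cell_row (la mu : seq nat) (x : skew_cell la mu) : nat :=
  (cell_pair x).1.
Definition cell_col (la mu : seq nat) (x : skew_cell la mu) : nat :=
  (cell_pair x).2.

Definition skew_size (la mu : seq nat) : nat := #|{: skew_cell la mu}|.

Definition is_syt (la mu : seq nat) (T : {ffun skew_cell la mu -> nat}) : bool :=
  [&& perm_eq (codom T) (iota 1 (skew_size la mu)),
      [forall x, forall y, (cell_row x == cell_row y) &&
         (cell_col x < cell_col y) ==> (T x < T y)]
    & [forall x, forall y, (cell_col x == cell_col y) &&
         (cell_row x < cell_row y) ==> (T x < T y)]].

Record syt (la mu : seq nat) :=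
  Syt { syt_label :> {ffun skew_cell la mu -> nat}; _ : is_syt syt_label }.
HB.instance Definition _ (la mu : seq nat) := [isSub for @syt_label la mu].
HB.instance Definition _ (la mu : seq nat) := [Choice of syt la mu by <:].

Definition adjacent (la mu : seq nat) (x y : skew_cell la mu) : bool :=
  ((cell_row x == cell_row y) &&
     ((cell_col x == (cell_col y).+1) || (cell_col y == (cell_col x).+1))) ||
  ((cell_col x == cell_col y) &&
     ((cell_row x == (cell_row y).+1) || (cell_row y == (cell_row x).+1))).

Definition swap_label (i l : nat) : nat :=
  if l == i then i.+1 else if l == i.+1 then i else l.

Definition rho_label (la mu : seq nat) (i : nat)
    (T : {ffun skew_cell la mu -> nat}) : {ffun skew_cell la mu -> nat} :=
  if [exists x, exists y, [&& T x == i, T y == i.+1 & adjacent x y]] then T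
  else [ffun x => swap_label i (T x)].

Lemma rho_label_syt (la mu : seq nat) (i : nat) (T : syt la mu) :
  sorted geq la -> sorted geq mu -> 0 < i < skew_size la mu ->
  is_syt (rho_label i T).
Proof.
move=> sla smu hi; case: T => T hT /=; rewrite /rho_label.
case: ifPn => // /existsPn nadj.
have {}nadj x y : T x = i -> T y = i.+1 -> ~~ adjacent x y.
  move=> Tx Ty; have /existsPn/(_ y) := nadj x.
  by rewrite Tx Ty !eqxx.
case/and3P: hT => pT rT cT.
have {}rT x y : cell_row x = cell_row y -> cell_col x < cell_col y -> T x < T y.
  move=> e l; move/forallP: rT => /(_ x)/forallP/(_ y)/implyP; apply.
  by rewrite e eqxx l.
have {}cT x y : cell_col x = cell_col y -> cell_row x < cell_row y -> T x < T y.
  move=> e l; move/forallP: cT => /(_ x)/forallP/(_ y)/implyP; apply.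
  by rewrite e eqxx l.
have geq_tr : transitive geq by move=> a b c /=; lia.
have nth_anti (s : seq nat) a b : sorted geq s -> a <= b -> nth 0 s b <= nth 0 s a.
  move=> ss le_ab; case: (ltnP b (size s)) => hb; last by rewrite nth_default.
  apply: (sorted_leq_nth geq_tr _ 0 ss) => //; rewrite ?inE; try lia.
  by move=> c /=; lia.
have swap_mono x y : T x < T y -> ~ (T x = i /\ T y = i.+1) ->
    swap_label i (T x) < swap_label i (T y).
  by rewrite /swap_label; do ![case: eqP => ?]; lia.
have swapK l : swap_label i (swap_label i l) = l.
  rewrite /swap_label; have [->|/eqP ni] := eqVneq l i.
    by rewrite eqxx; case: eqP; lia.
  have [->|/eqP nSi] := eqVneq l i.+1; first by rewrite eqxx.
  by do ![case: eqP => //].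
apply/and3P; split.
- have -> : codom [ffun x => swap_label i (T x)] = map (swap_label i) (codom T).
    by rewrite /codom /image_mem -map_comp; apply: eq_map => x; rewrite /= ffunE.
  have /permPl := perm_map (swap_label i) pT; move=> ->.
  have inj : injective (swap_label i).
    apply: (can_inj (g := swap_label i)) => a; exact: swapK.
  apply: uniq_perm; rewrite ?(map_inj_uniq inj) ?iota_uniq // => l.
  rewrite -{1}[l]swapK (mem_map inj) !mem_iota /swap_label.
  by do ![case: eqP => ?]; lia.
- apply/forallP => x; apply/forallP => y; apply/implyP => /andP[/eqP e l].
  rewrite !ffunE; apply: swap_mono; first exact: rT.
  case=> Tx Ty; have := nadj x y Tx Ty; rewrite /adjacent e eqxx /=.
  case: (ltnP (cell_col x).+1 (cell_col y)) => [lt|ge]; last by lia.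
  move=> _.
  have hlt : (cell_col x).+1 < head 0 la.
    by apply: ltn_trans lt _; apply: ltn_ord.
  have hz : nth 0 mu (cell_pair x).1 <= Ordinal hlt < nth 0 la (cell_pair x).1.
    have := valP x; have := valP y; move: e lt; rewrite /cell_row /cell_col /=.
    by move=> <-; lia.
  pose z := @SkewCell la mu ((cell_pair x).1, Ordinal hlt) hz.
  have h1 : T x < T z by apply: rT; rewrite /cell_row /cell_col //=.
  have h2 : T z < T y by apply: rT; rewrite -?e /cell_row /cell_col //=.
  by lia.
- apply/forallP => x; apply/forallP => y; apply/implyP => /andP[/eqP e l].
  rewrite !ffunE; apply: swap_mono; first exact: cT.
  case=> Tx Ty; have := nadj x y Tx Ty; rewrite /adjacent e eqxx /=.
  case: (ltnP (cell_row x).+1 (cell_row y)) => [lt|ge]; last by lia.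
  move=> _.
  have hlt : (cell_row x).+1 < size la.
    by apply: ltn_trans lt _; apply: ltn_ord.
  have hz : nth 0 mu (Ordinal hlt) <= (cell_pair x).2 < nth 0 la (Ordinal hlt).
    have := nth_anti mu _ _ smu (leqnSn (cell_row x)).
    have := nth_anti la _ _ sla (ltnW lt).
    have := valP x; have := valP y; move: e; rewrite /cell_row /cell_col /=.
    by lia.
  pose z := @SkewCell la mu (Ordinal hlt, (cell_pair x).2) hz.
  have h1 : T x < T z by apply: cT; rewrite /cell_row /cell_col //=.
  have h2 : T z < T y by apply: cT; rewrite -?e /cell_row /cell_col //=.
  by lia.
Qed.

(* By [rho_label_syt], the default value T is never used when la and mu are
   partitions and 1 <= i <= N - 1. *)
Definition rho (la mu : seq nat) (i : nat) (T : syt la mu) : syt la mu :=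
  insubd T (rho_label i T).

Definition Pro (la mu : seq nat) (T : syt la mu) : syt la mu :=
  foldl (fun U i => rho i U) T (iota 1 (skew_size la mu).-1).

Lemma skew_size_two_row (n k m : nat) :
  m <= n + k -> skew_size [:: n + k; m] [:: k] = n + m.
Proof.
move=> hm; rewrite /skew_size -[RHS](_ : #|{: 'I_n + 'I_m}| = _); last first.
  by rewrite card_sum !card_ord.
have h0 (j : 'I_n) : k + j < n + k by rewrite addnC ltn_add2r.
have h1 (j : 'I_m) : j < n + k by apply: leq_trans hm.
have g0 (j : 'I_n) : nth 0 [:: k] (@Ordinal 2 0 isT) <= Ordinal (h0 j)
    < nth 0 [:: n + k; m] (@Ordinal 2 0 isT).
  by rewrite /= h0 leq_addr.
have g1 (j : 'I_m) : nth 0 [:: k] (@Ordinal 2 1 isT) <= Ordinal (h1 j)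
    < nth 0 [:: n + k; m] (@Ordinal 2 1 isT).
  by rewrite /= ltn_ord.
pose f (s : 'I_n + 'I_m) : skew_cell [:: n + k; m] [:: k] :=
  match s with
  | inl j => @SkewCell [:: n + k; m] [:: k]
               (@Ordinal 2 0 isT, Ordinal (h0 j)) (g0 j)
  | inr j => @SkewCell [:: n + k; m] [:: k]
               (@Ordinal 2 1 isT, Ordinal (h1 j)) (g1 j)
  end.
symmetry; apply: (@bij_eq_card _ _ f); apply: inj_card_bij.
  move=> [j|j] [j'|j'] //= /(congr1 (fun x => (cell_row x, cell_col x))) [] //.
  - by move/addnI/val_inj => ->.
  - by move=> e; congr (inr _); apply: val_inj.
apply: (@leq_trans #|codom f|); last by rewrite leq_image_card.
apply/subset_leq_card/subsetP => x _; apply/codomP.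
case: x => [[[[|[|//]] hr] [c hc]] /= hx].
- have hj : c - k < n by move: (hx); rewrite /=; lia.
  exists (inl (Ordinal hj)); apply: val_inj => /=.
  by congr (_, _); apply: val_inj => //=; move: hx; rewrite /=; lia.
- have hj : c < m by move: (hx); rewrite /=; lia.
  exists (inr (Ordinal hj)); apply: val_inj => /=.
  by congr (_, _); apply: val_inj.
Qed.

(* Main.v *)
Require Import Defs.
From mathcomp Require Import all_boot all_order.
From mathcomp Require Import zify.

(** A tableau [T] is determined by which first-row labels are smaller than which
    second-row labels. Writing [T1 a] and [T2 b] for the labels of the [a]-th
    cell of the first row and the [b]-th cell of the second row, the pairs
    [(a, b)] with [b >= a + k] always satisfy [T1 a < T2 b], and the others form
    [Int]; hence [T |-> {(a, b) in Int | T1 a < T2 b}] is a bijection onto the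
    order ideals, whose inverse labels the cells by their rank in the total order
    that an ideal defines.

    The toggle at [p] adds or removes [p] whenever the result is an ideal. By the
    bijection, this happens at [p = (a, b)] exactly when some tableau orders the
    labels as [T] does except that it exchanges [T1 a] and [T2 b], that is, when
    [T1 a] and [T2 b] are [i] and [i + 1] for some [i]. The labels below [i] are
    then those of the cells to the left of the two, so that [i = a + b + 1]. Hence
    at most one toggle in [c_t] acts nontrivially, and it does what [rho_(t+1)]
    does: the bijection intertwines [c_t] and [rho_(t+1)] for each [t]. *)

Set Implicit Arguments.
Unset Strict Implicit.
Unset Printing Implicit Defensive.

Import Order.TTheory.

Section FoldrFixed.

Variables (A : eqType) (S : Type) (f : A -> S -> S).

Lemma foldr_fixed x s : {in s, forall a, f a x = x} -> foldr f x s = x.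
Proof.
elim: s => //= a s IHs fix_s; rewrite IHs ?fix_s ?mem_head // => b bs.
by rewrite fix_s // inE bs orbT.
Qed.

Lemma foldr_single_mover p x s : uniq s -> p \in s ->
    {in s, forall a, a != p -> f a x = x} ->
    {in s, forall a, a != p -> f a (f p x) = f p x} ->
  foldr f x s = f p x.
Proof.
move=> s_uniq ps; case/splitPr: ps s_uniq => s1 s2.
rewrite uniq_catC /= mem_cat negb_or => /andP[/andP[p_s2 p_s1] _] fix_x fix_px.
rewrite foldr_cat /= (foldr_fixed (s := s2)) ?foldr_fixed // => a a_s.
  by apply: fix_px; [rewrite mem_cat a_s | apply: contraNneq p_s1 => <-].
by apply: fix_x; [rewrite mem_cat inE a_s !orbT | apply: contraNneq p_s2 => <-].
Qed.

End FoldrFixed.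

Lemma card_ord_ltn n A : A <= n -> #|[set i : 'I_n | i < A]| = A.
Proof.
by move=> le_An; rewrite -sum1dep_card (big_ord_narrow le_An) sum1_card card_ord.
Qed.

Section Rank.

Variables (S : finType) (le : rel S).
Hypotheses (le_total : total le) (le_trans : transitive le).
Hypothesis le_anti : antisymmetric le.

Definition rank x := #|[set z | le z x]|.

Lemma leq_rank x y : (rank x <= rank y) = le x y.
Proof.
case: (boolP (le x y)) => [le_xy | nle_xy].
  by apply/subset_leq_card/subsetP => z; rewrite !inE => /le_trans; apply.
have /orP[|le_yx] := le_total x y; first by rewrite (negPf nle_xy).
apply/negbTE; rewrite -ltnNge; apply/proper_card/properP; split.
  by apply/subsetP => z; rewrite !inE => /le_trans; apply.
by exists x; rewrite inE ?(negPf nle_xy) // -[le x x]orbb le_total.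
Qed.

Lemma rank_inj : injective rank.
Proof. by move=> x y e; apply: le_anti; rewrite -!leq_rank e leqnn. Qed.

Lemma perm_codom_rank : perm_eq (codom rank) (iota 1 #|S|).
Proof.
have rank_uniq : uniq (codom rank) by apply/injectiveP/rank_inj.
have rank_range : {subset codom rank <= iota 1 #|S|}.
  move=> _ /codomP[x ->]; rewrite mem_iota add1n ltnS max_card andbT.
  by apply/card_gt0P; exists x; rewrite inE -[le x x]orbb le_total.
apply: uniq_perm; rewrite ?iota_uniq //.
have [|//] := uniq_min_size rank_uniq rank_range.
by rewrite size_iota size_codom.
Qed.

End Rank.

Section Shuffle.

Variables (dA dB : Order.disp_t) (A : orderType dA) (B : orderType dB).
Variable precedes : A -> B -> bool.
Hypothesis precedes_mono : forall a a' b b',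
  (a' <= a)%O -> (b <= b')%O -> precedes a b -> precedes a' b'.

Definition shuffle_le (s s' : A + B) : bool :=
  match s, s' with
  | inl a, inl a' => (a <= a')%O
  | inl a, inr b => precedes a b
  | inr b, inl a => ~~ precedes a b
  | inr b, inr b' => (b <= b')%O
  end.

Lemma shuffle_le_total : total shuffle_le.
Proof. by move=> [a|b] [a'|b'] /=; rewrite ?le_total ?orbN ?orNb. Qed.

Lemma shuffle_le_anti : antisymmetric shuffle_le.
Proof.
by move=> [a|b] [a'|b'] /=; rewrite ?andbN ?andNb // => /le_anti ->.
Qed.

Lemma shuffle_le_trans : transitive shuffle_le.
Proof.
move=> [a|b] [a'|b'] [a''|b''] /=; try exact: le_trans.
- by move=> le_a; apply: precedes_mono le_a (lexx _).
- by move=> nprec le_a; apply: contra nprec; apply: precedes_mono.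
- move=> nprec prec; rewrite leNgt; apply: contra nprec => /ltW le_b.
  exact: precedes_mono prec.
- move=> prec nprec; rewrite leNgt; apply: contra nprec => /ltW le_a.
  exact: precedes_mono prec.
- by move=> prec le_b; apply: precedes_mono prec.
- by move=> le_b; apply: contra; apply: precedes_mono.
Qed.

End Shuffle.

Section Toggle.

Variables (d : Order.disp_t) (P : finPOrderType d).
Implicit Types (p q : P) (I J : ideal P).

Lemma ideal_inj I J : I =i J -> I = J.
Proof. by move=> eq_IJ; apply/val_inj/setP. Qed.

Lemma ideal_down I p q : p \in I -> (q <= p)%O -> q \in I.
Proof.
by case: I => D /= /forall_inP downD /downD/forallP/(_ q)/implyP.
Qed.

Lemma toggle_flip p I J :
  (forall q, (q \in J) = (q \in I) (+) (q == p)) -> toggle p I = J.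
Proof.
move=> flipJ; apply: ideal_inj => q; rewrite flipJ /= /toggle_set.
have Jp : (p \in J) = (p \notin I) by rewrite flipJ eqxx addbT.
have off_p r : r != p -> (r \in J) = (r \in I).
  by move=> /negPf ne_rp; rewrite flipJ ne_rp addbF.
have [Ip|nIp] /= := boolP (p \in I).
  suff -> : [forall r, (p < r)%O ==> (r \notin I)].
    by rewrite in_setD1; case: eqP => [->|_]; rewrite ?Ip ?addbF.
  apply/forallP => r; apply/implyP => lt_pr; rewrite -off_p ?gt_eqF //.
  by apply: contraL Ip => Jr; rewrite -Jp (ideal_down Jr (ltW lt_pr)).
suff -> : [forall r, (r < p)%O ==> (r \in I)].
  by rewrite in_setU1; case: eqP => [->|_]; rewrite ?(negPf nIp) ?addbF.
apply/forallP => r; apply/implyP => lt_rp; rewrite -off_p ?lt_eqF //.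
by apply: ideal_down (ltW lt_rp); rewrite Jp.
Qed.

Variant toggle_spec p I : ideal P -> Prop :=
  | ToggleFixed : toggle_spec p I I
  | ToggleFlip J of (forall q, (q \in J) = (q \in I) (+) (q == p)) :
      toggle_spec p I J.

Lemma toggleP p I : toggle_spec p I (toggle p I).
Proof.
have [toggle_out|toggle_in|e] : [\/ p \notin I /\ toggle_set p I = p |: I,
    p \in I /\ toggle_set p I = I :\ p | toggle_set p I = I].
- rewrite /toggle_set; case: ifP => [/andP[nIp _]|_]; first by constructor 1.
  by case: ifP => [/andP[Ip _]|_]; [constructor 2 | constructor 3].
- apply: ToggleFlip => q; rewrite /= (proj2 toggle_out) in_setU1.
  by case: eqP => [->|_]; rewrite ?(negPf (proj1 toggle_out)) ?addbF.
- apply: ToggleFlip => q; rewrite /= (proj2 toggle_in) in_setD1.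
  by case: eqP => [->|_]; rewrite ?(proj1 toggle_in) ?addbF.
have -> : toggle p I = I by apply: val_inj.
exact: ToggleFixed.
Qed.

End Toggle.

Definition consecutive i u v :=
  ((u == i) && (v == i.+1)) || ((u == i.+1) && (v == i)).

Lemma swap_label_ltn i u v : u != v ->
  (swap_label i u < swap_label i v) = (u < v) (+) consecutive i u v.
Proof. by rewrite /swap_label /consecutive; do ![case: ifP => /eqP ?]; lia. Qed.

Lemma consecutive_swap_label i u v :
  consecutive i (swap_label i u) (swap_label i v) = consecutive i u v.
Proof. by rewrite /swap_label /consecutive; do ![case: ifP => /eqP ?]; lia. Qed.

Section SkewTableau.

Variables la mu : seq nat.
Implicit Types (T : syt la mu) (x y z : skew_cell la mu).

Lemma skew_cell_inj x y :
  cell_row x = cell_row y -> cell_col x = cell_col y -> x = y.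
Proof.
move=> eq_row eq_col; apply: val_inj => /=.
case: x y eq_row eq_col => [[r c] ?] [[r' c'] ?] /=.
by rewrite /cell_row /cell_col /= => /val_inj-> /val_inj->.
Qed.

Lemma syt_perm T : perm_eq (codom T) (iota 1 (skew_size la mu)).
Proof. by case: T => U /= /and3P[]. Qed.

Lemma syt_inj T : injective T.
Proof.
apply/injectiveP; rewrite /injectiveb /dinjectiveb.
by rewrite (perm_uniq (syt_perm T)) iota_uniq.
Qed.

Lemma syt_range T x : 0 < T x <= skew_size la mu.
Proof. by have := codom_f T x; rewrite (perm_mem (syt_perm T)) mem_iota. Qed.

Lemma syt_label_surj T v : 0 < v <= skew_size la mu -> exists x, T x = v.
Proof.
move=> v_range; have : v \in codom T.
  by rewrite (perm_mem (syt_perm T)) mem_iota add1n ltnS.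
by case/codomP => x ->; exists x.
Qed.

Lemma card_label_ltn T v : v <= skew_size la mu -> #|[set x | T x < v.+1]| = v.
Proof.
move=> le_vN; rewrite cardsE cardE size_filter -enumT -(count_map T (ltn^~ v.+1)).
rewrite -codomE (permP (syt_perm T)) -size_filter.
by rewrite (eq_filter (a2 := fun l => l < 1 + v)) // filter_iota_ltn ?size_iota.
Qed.

Lemma syt_order_inj T T' : (forall x y, T x < T y -> T' x < T' y) -> T = T'.
Proof.
move=> homo_lt.
have eq_lt x y : (T x < T y) = (T' x < T' y).
  case: (ltngtP (T x)) => [/homo_lt->//|/homo_lt/ltnW|/syt_inj->].
    by rewrite leqNgt => /negPf.
  by rewrite ltnn.
have syt_label (U : syt la mu) x : U x = #|[set y | U y < U x]|.+1.
  have /andP[] := syt_range U x; case: (U x) => // v _ lt_vN.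
  by rewrite card_label_ltn 1?ltnW.
apply/val_inj/ffunP => x /=; rewrite (syt_label T) (syt_label T').
by congr _.+1; apply: eq_card => y; rewrite !inE eq_lt.
Qed.

Lemma syt_row T x y :
  cell_row x = cell_row y -> cell_col x < cell_col y -> T x < T y.
Proof.
case: T => U /= /and3P[_ /forallP/(_ x)/forallP/(_ y)/implyP rowU _].
by move=> eq_row lt_col; apply: rowU; rewrite eq_row eqxx.
Qed.

Lemma syt_col T x y :
  cell_col x = cell_col y -> cell_row x < cell_row y -> T x < T y.
Proof.
case: T => U /= /and3P[_ _ /forallP/(_ x)/forallP/(_ y)/implyP colU].
by move=> eq_col lt_row; apply: colU; rewrite eq_col eqxx.
Qed.

Lemma syt_row_ltn T x y :
  cell_row x = cell_row y -> (T x < T y) = (cell_col x < cell_col y).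
Proof.
move=> eq_row; case: (ltngtP (cell_col x)) => [lt_col|lt_col|eq_col].
- exact: syt_row.
- by rewrite ltnNge ltnW ?syt_row.
- by rewrite (skew_cell_inj eq_row eq_col) ltnn.
Qed.

Lemma syt_southeast T x y : sorted geq la ->
  cell_row x < cell_row y -> cell_col x <= cell_col y -> T x < T y.
Proof.
move=> la_part lt_row le_col.
have la_anti : nth 0 la (cell_row y) <= nth 0 la (cell_row x).
  apply: (sorted_leq_nth _ _ 0 la_part); rewrite ?inE ?ltn_ord ?(ltnW lt_row) //.
    by move=> ? ? ? /=; lia.
  by move=> ? /=.
have corner_cell : nth 0 mu (cell_row x) <= cell_col y < nth 0 la (cell_row x).
  have /andP[mu_x _] := valP x; have /andP[_ la_y] := valP y.
  by rewrite (leq_trans mu_x le_col) (leq_trans la_y la_anti).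
pose corner := @SkewCell la mu ((cell_pair x).1, (cell_pair y).2) corner_cell.
apply: (@leq_ltn_trans (T corner)); last exact: syt_col.
by rewrite leqNgt syt_row_ltn // -leqNgt.
Qed.

Lemma syt_of_order (le : rel (skew_cell la mu)) :
    total le -> transitive le -> antisymmetric le ->
    (forall x y, cell_row x = cell_row y -> cell_col x < cell_col y ->
       ~~ le y x) ->
    (forall x y, cell_col x = cell_col y -> cell_row x < cell_row y ->
       ~~ le y x) ->
  exists T, forall x y, (T x < T y) = ~~ le y x.
Proof.
move=> le_total le_trans le_anti row_le col_le.
have rank_ltn x y :
    ([ffun z => rank le z] x < [ffun z => rank le z] y) = ~~ le y x.
  by rewrite ltnNge !ffunE leq_rank.
suff rank_syt : is_syt [ffun z => rank le z] by exists (Syt rank_syt).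
apply/and3P; split.
- rewrite (eq_codom (g := rank le)) ?perm_codom_rank // => x.
  by rewrite ffunE.
- apply/'forall_forallP => x y; apply/implyP => /andP[/eqP eq_row lt_col].
  by rewrite rank_ltn row_le.
- apply/'forall_forallP => x y; apply/implyP => /andP[/eqP eq_col lt_row].
  by rewrite rank_ltn col_le.
Qed.

(* [T'] would have to reverse the order of [x] or of [y] with respect to any
   cell whose label lies strictly between [T x] and [T y]. *)
Lemma single_reversal_succ T T' x y : T x < T y -> T' y < T' x ->
    (forall u v, T u < T v -> T' v < T' u -> u = x /\ v = y) ->
  T y = (T x).+1.
Proof.
move=> lt_xy lt_yx only_xy; apply/eqP; rewrite eqn_leq lt_xy andbT leqNgt.
apply/negP => lt_Sx_y.
have [|z Tz] := @syt_label_surj T (T x).+1; first by have := syt_range T y; lia.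
rewrite -Tz in lt_Sx_y; have lt_xz : T x < T z by rewrite Tz.
case: (ltngtP (T' z) (T' x)) => [lt_zx|lt_xz'|/syt_inj eq_zx].
- by have [_ eq_zy] := only_xy x z lt_xz lt_zx; rewrite eq_zy ltnn in lt_Sx_y.
- have [eq_zx _] := only_xy z y lt_Sx_y (ltn_trans lt_yx lt_xz').
  by rewrite eq_zx ltnn in lt_xz.
- by rewrite eq_zx ltnn in lt_xz.
Qed.

Section Rho.

Hypotheses (la_part : sorted geq la) (mu_part : sorted geq mu).
Variable i : nat.
Hypothesis i_range : 0 < i < skew_size la mu.

Lemma val_rho T : rho i T = rho_label i T :> {ffun _}.
Proof. by rewrite [LHS](insubdK T) //; apply: rho_label_syt. Qed.

Lemma consecutive_rho T x y :
  consecutive i (rho i T x) (rho i T y) = consecutive i (T x) (T y).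
Proof.
rewrite val_rho /rho_label; case: ifP => // _.
by rewrite !ffunE consecutive_swap_label.
Qed.

Lemma rho_ltn T x y : x != y -> ~~ adjacent x y ->
  (rho i T x < rho i T y) = (T x < T y) (+) consecutive i (T x) (T y).
Proof.
move=> ne_xy nadj_xy; rewrite val_rho /rho_label.
case: ifP => [/'exists_existsP[x' [y' /and3P[/eqP <- /eqP Ty' adj]]]|_].
  suff /negPf-> : ~~ consecutive (T x') (T x) (T y) by rewrite addbF.
  apply: contra nadj_xy; rewrite /consecutive -Ty' !(inj_eq (@syt_inj T)).
  by case/orP=> /andP[/eqP-> /eqP->] //; move: adj; rewrite /adjacent; lia.
by rewrite !ffunE swap_label_ltn // (inj_eq (@syt_inj T)).
Qed.

End Rho.

End SkewTableau.

Section TwoRow.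

Variables n k m : nat.
Hypothesis le_m_nk : m <= n + k.

Local Notation cell := (skew_cell [:: n + k; m] [:: k]).
Local Notation tableau := (syt [:: n + k; m] [:: k]).
Local Notation poset := (Int n k m).
Implicit Types (T : tableau) (x y : cell) (p q : poset) (I : ideal poset).

Let outer_part : sorted geq [:: n + k; m]. Proof. by rewrite /= le_m_nk. Qed.

Fact top_col_subproof (a : 'I_n) : k + a < n + k.
Proof. by rewrite addnC ltn_add2r. Qed.

Fact top_cell_subproof (a : 'I_n) :
  nth 0 [:: k] (@Ordinal 2 0 isT) <= Ordinal (top_col_subproof a)
    < nth 0 [:: n + k; m] (@Ordinal 2 0 isT).
Proof. by rewrite /= leq_addr top_col_subproof. Qed.

Definition top_cell (a : 'I_n) : cell :=
  @SkewCell [:: n + k; m] [:: k]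
    (@Ordinal 2 0 isT, Ordinal (top_col_subproof a)) (top_cell_subproof a).

Fact bottom_cell_subproof (b : 'I_m) :
  nth 0 [:: k] (@Ordinal 2 1 isT) <= widen_ord le_m_nk b
    < nth 0 [:: n + k; m] (@Ordinal 2 1 isT).
Proof. by rewrite /= ltn_ord. Qed.

Definition bottom_cell (b : 'I_m) : cell :=
  @SkewCell [:: n + k; m] [:: k]
    (@Ordinal 2 1 isT, widen_ord le_m_nk b) (bottom_cell_subproof b).

Definition row_cell (s : 'I_n + 'I_m) : cell :=
  match s with inl a => top_cell a | inr b => bottom_cell b end.

Lemma row_cell_inj : injective row_cell.
Proof.
move=> [a|b] [a'|b'] /(congr1 (fun x => (cell_row x, cell_col x))) [] //.
  by move/addnI/val_inj => ->.
by move=> e; congr (inr _); apply: val_inj.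
Qed.

Lemma row_cell_bij : bijective row_cell.
Proof.
apply: inj_card_bij row_cell_inj _.
by have := skew_size_two_row le_m_nk; rewrite /skew_size card_sum !card_ord => ->.
Qed.

Variant two_row_cell_spec : cell -> Prop :=
  | TopCell a : two_row_cell_spec (top_cell a)
  | BottomCell b : two_row_cell_spec (bottom_cell b).

Lemma two_row_cellP x : two_row_cell_spec x.
Proof.
by have [g _ gK] := row_cell_bij; rewrite -(gK x); case: (g x); constructor.
Qed.

Lemma label_top_ltn T a a' : (T (top_cell a) < T (top_cell a')) = (a < a').
Proof. by rewrite syt_row_ltn // /cell_col /= ltn_add2l. Qed.

Lemma label_bottom_ltn T b b' :
  (T (bottom_cell b) < T (bottom_cell b')) = (b < b').
Proof. by rewrite syt_row_ltn. Qed.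

Lemma label_top_bottom_neq T a b : T (top_cell a) != T (bottom_cell b).
Proof. by apply/eqP => /syt_inj/(@row_cell_inj (inl a) (inr b)). Qed.

Lemma label_bottom_top_bound T (a : 'I_n) (b : 'I_m) :
  T (bottom_cell b) < T (top_cell a) -> b < a + k.
Proof.
rewrite ltnNge => /negP nle_label; rewrite ltnNge; apply/negP => le_ab.
case: nle_label; apply: ltnW (syt_southeast _ outer_part _ _) => //.
by rewrite /cell_col /= addnC.
Qed.

Lemma card_two_row (Q : pred cell) :
  #|[set x | Q x]| = #|[set a | Q (top_cell a)]| + #|[set b | Q (bottom_cell b)]|.
Proof.
rewrite -!sum1dep_card (reindex row_cell) ?big_sumType //=.
exact/onW_bij/row_cell_bij.
Qed.

Lemma consecutive_top_bottom T i (a : 'I_n) (b : 'I_m) :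
  consecutive i (T (top_cell a)) (T (bottom_cell b)) -> i = (a + b).+1.
Proof.
move=> cons_ab; have ne_top a' := label_top_bottom_neq T a' b.
have ne_bottom b' := label_top_bottom_neq T a b'.
have [i_gt0 le_iN] : 0 < i /\ i.-1 <= skew_size [:: n + k; m] [:: k].
  have := syt_range T (top_cell a); have := syt_range T (bottom_cell b).
  by move: cons_ab; rewrite /consecutive; lia.
rewrite -(prednK i_gt0) -(card_label_ltn T le_iN) prednK // card_two_row.
congr (_ + _).+1.
  rewrite -[RHS](card_ord_ltn (ltnW (ltn_ord a))); apply: eq_card => a'.
  have := ne_top a'; have := label_top_ltn T a' a.
  by move: cons_ab; rewrite !inE /consecutive; lia.
rewrite -[RHS](card_ord_ltn (ltnW (ltn_ord b))); apply: eq_card => b'.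
have := ne_bottom b'; have := label_bottom_ltn T b' b.
by move: cons_ab; rewrite !inE /consecutive; lia.
Qed.

Definition top_of p := top_cell (int_pair p).1.
Definition bottom_of p := bottom_cell (int_pair p).2.

Lemma top_bottom_nadj p : ~~ adjacent (top_of p) (bottom_of p).
Proof. by have := valP p; rewrite /adjacent /cell_col /=; lia. Qed.

Lemma top_bottom_of_inj p q :
  top_of p = top_of q -> bottom_of p = bottom_of q -> p = q.
Proof.
move=> /(@row_cell_inj (inl _) (inl _))[eq_a].
move=> /(@row_cell_inj (inr _) (inr _))[eq_b]; apply: val_inj => /=.
by rewrite [LHS]surjective_pairing eq_a eq_b -surjective_pairing.
Qed.

Definition top_first T : {set poset} := [set p | T (top_of p) < T (bottom_of p)].

Lemma top_first_ideal T : is_ideal (top_first T).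
Proof.
apply/forall_inP => p; rewrite inE => lt_p; apply/forallP => q.
apply/implyP => /andP[le_a le_b]; rewrite inE.
apply: (@leq_ltn_trans (T (top_of p))).
  by rewrite leqNgt label_top_ltn -leqNgt.
by apply: (leq_trans lt_p); rewrite leqNgt label_bottom_ltn -leqNgt.
Qed.

Definition ideal_of_syt T : ideal poset := Ideal (top_first_ideal T).

Lemma mem_ideal_of_syt T p :
  (p \in ideal_of_syt T) = (T (top_of p) < T (bottom_of p)).
Proof. by rewrite inE. Qed.

Lemma notin_ideal_of_syt T p :
  (p \notin ideal_of_syt T) = (T (bottom_of p) < T (top_of p)).
Proof.
rewrite mem_ideal_of_syt -leqNgt leq_eqVlt eq_sym.
by rewrite (negPf (label_top_bottom_neq _ _ _)).
Qed.

Variant reversal_spec T T' : cell -> cell -> Prop :=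
  | ReversalOut p of p \in ideal_of_syt T & p \notin ideal_of_syt T' :
      reversal_spec T T' (top_of p) (bottom_of p)
  | ReversalIn p of p \notin ideal_of_syt T & p \in ideal_of_syt T' :
      reversal_spec T T' (bottom_of p) (top_of p).

Lemma reversalP T T' x y : T x < T y -> T' y < T' x -> reversal_spec T T' x y.
Proof.
have [a|b] := two_row_cellP x; have [a'|b'] := two_row_cellP y.
- by rewrite !label_top_ltn; lia.
- move=> lt_T lt_T'; have lt_ba := label_bottom_top_bound lt_T'.
  pose p : poset := @IntElt n k m (a, b') lt_ba.
  by apply: (@ReversalOut _ _ p); rewrite ?notin_ideal_of_syt ?mem_ideal_of_syt.
- move=> lt_T lt_T'; have lt_ba := label_bottom_top_bound lt_T.
  pose p : poset := @IntElt n k m (a', b) lt_ba.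
  by apply: (@ReversalIn _ _ p); rewrite ?notin_ideal_of_syt ?mem_ideal_of_syt.
- by rewrite !label_bottom_ltn; lia.
Qed.

Lemma ideal_of_syt_inj : injective ideal_of_syt.
Proof.
move=> T T' eq_I; apply: syt_order_inj => x y lt_xy.
case: (ltngtP (T' x)) => // [lt_yx|/syt_inj eq_xy].
  case: (reversalP lt_xy lt_yx) => p; rewrite eq_I => Ip;
    by rewrite ?Ip ?(negPf Ip).
by rewrite eq_xy ltnn in lt_xy.
Qed.

(* True at the pairs outside [Int], those with [a + k <= b]. *)
Definition precedes I (a : 'I_n) (b : 'I_m) : bool :=
  [forall p : poset, (int_pair p == (a, b)) ==> (p \in I)].

Lemma precedes_int_pair I p :
  precedes I (int_pair p).1 (int_pair p).2 = (p \in I).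
Proof.
rewrite /precedes -surjective_pairing; apply/forallP/idP => [/(_ p)|Ip q].
  by rewrite eqxx.
by apply/implyP => /eqP/val_inj->.
Qed.

Lemma precedes_mono I (a a' : 'I_n) (b b' : 'I_m) :
  (a' <= a)%O -> (b <= b')%O -> precedes I a b -> precedes I a' b'.
Proof.
rewrite !leEord => le_a le_b prec_ab.
apply/forallP => q; apply/implyP => /eqP def_q.
have lt_ba : b < a + k by have := valP q; rewrite [val q]def_q /=; lia.
pose p : poset := @IntElt n k m (a, b) lt_ba.
apply: (@ideal_down _ _ I p); first by rewrite -precedes_int_pair.
by rewrite /Order.le /= /int_le /int_a /int_b def_q /= le_a le_b.
Qed.

Lemma ideal_of_syt_surj I : exists T, ideal_of_syt T == I.
Proof.
have [code row_cellK codeK] := row_cell_bij.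
pose le x y := shuffle_le (precedes I) (code x) (code y).
have le_row_cell s s' :
    le (row_cell s) (row_cell s') = shuffle_le (precedes I) s s'.
  by rewrite /le !row_cellK.
have [|||x y|x y|T T_lt] := @syt_of_order _ _ le.
- by move=> x y; apply: shuffle_le_total.
- by move=> y x z; apply/shuffle_le_trans/precedes_mono.
- by move=> x y /shuffle_le_anti; apply: (can_inj codeK).
- case: (two_row_cellP x) (two_row_cellP y) => [a|b] [a'|b'] //.
    rewrite (le_row_cell (inl a') (inl a)) /cell_col /= leEord ltn_add2l.
    by rewrite -ltnNge.
  by rewrite (le_row_cell (inr b') (inr b)) /= leEord -ltnNge.
- case: (two_row_cellP x) (two_row_cellP y) => [a|b] [a'|b'] //.
  rewrite (le_row_cell (inr b') (inl a)) /= negbK /cell_col /= => eq_col _.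
  apply/forallP => p; apply/implyP => /eqP def_p.
  by have := valP p; rewrite [val p]def_p /=; lia.
exists T; apply/eqP/ideal_inj => p; rewrite mem_ideal_of_syt T_lt.
by rewrite (le_row_cell (inr _) (inl _)) /= negbK precedes_int_pair.
Qed.

Lemma ideal_of_syt_bij : bijective ideal_of_syt.
Proof.
pose syt_of I := xchoose (ideal_of_syt_surj I).
have syt_ofK : cancel syt_of ideal_of_syt.
  by move=> I; apply/eqP/(xchooseP (ideal_of_syt_surj I)).
by exists syt_of => // T; apply: ideal_of_syt_inj; rewrite syt_ofK.
Qed.

Definition swappable i T p := consecutive i (T (top_of p)) (T (bottom_of p)).

Lemma swappable_level T i p : swappable i T p -> i = (int_a p + int_b p).+1.
Proof. exact: consecutive_top_bottom. Qed.

Lemma swappable_inj T i p q : swappable i T p -> swappable i T q -> p = q.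
Proof.
have ne_pq := label_top_bottom_neq T (int_pair p).1 (int_pair q).2.
have ne_qp := label_top_bottom_neq T (int_pair q).1 (int_pair p).2.
rewrite /swappable /consecutive => swap_p swap_q.
apply: top_bottom_of_inj; apply: (@syt_inj _ _ T);
  by move: swap_p swap_q ne_pq ne_qp; rewrite /top_of /bottom_of; lia.
Qed.

Section Rho.

Variable i : nat.
Hypothesis i_range : 0 < i < n + m.

Let skew_i_range : 0 < i < skew_size [:: n + k; m] [:: k].
Proof. by rewrite skew_size_two_row. Qed.

Lemma mem_ideal_of_rho T p :
  (p \in ideal_of_syt (rho i T)) = (p \in ideal_of_syt T) (+) swappable i T p.
Proof.
rewrite !mem_ideal_of_syt (rho_ltn outer_part _ skew_i_range) //.
exact: top_bottom_nadj.
Qed.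

Lemma swappable_rho T p : swappable i (rho i T) p = swappable i T p.
Proof. by apply: (consecutive_rho outer_part). Qed.

Lemma toggle_swappable T p :
  swappable i T p -> toggle p (ideal_of_syt T) = ideal_of_syt (rho i T).
Proof.
move=> swap_p; apply: toggle_flip => q; rewrite mem_ideal_of_rho; congr (_ (+) _).
by apply/idP/eqP => [swap_q|->//]; apply: swappable_inj swap_q swap_p.
Qed.

End Rho.

Lemma swappable_of_flip T T' p :
    (forall q, (q \in ideal_of_syt T') = (q \in ideal_of_syt T) (+) (q == p)) ->
  exists i, swappable i T p.
Proof.
move=> flip_p.
have off_p q : (q \in ideal_of_syt T') != (q \in ideal_of_syt T) -> q = p.
  by rewrite flip_p; case: (q =P p) => // _; rewrite addbF eqxx.
have T'p : (p \in ideal_of_syt T') = (p \notin ideal_of_syt T).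
  by rewrite flip_p eqxx addbT.
have only_p x y : T x < T y -> T' y < T' x ->
    if p \in ideal_of_syt T then x = top_of p /\ y = bottom_of p
    else x = bottom_of p /\ y = top_of p.
  move=> lt_xy lt_yx; case: (reversalP lt_xy lt_yx) => q Tq T'q.
    by rewrite -(off_p q) ?Tq // (negPf T'q).
  by rewrite -(off_p q) ?(negPf Tq) // T'q.
have [Tp|nTp] := boolP (p \in ideal_of_syt T); move: only_p.
  rewrite Tp => /single_reversal_succ succ_p.
  exists (T (top_of p)); rewrite /swappable /consecutive succ_p ?eqxx //.
    by rewrite -mem_ideal_of_syt.
  by rewrite -notin_ideal_of_syt T'p negbK.
rewrite (negPf nTp) => /single_reversal_succ succ_p.
exists (T (bottom_of p)); rewrite /swappable /consecutive succ_p ?eqxx ?orbT //.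
  by rewrite -notin_ideal_of_syt.
by rewrite -mem_ideal_of_syt T'p.
Qed.

Lemma toggle_unswappable T p : ~~ swappable (int_a p + int_b p).+1 T p ->
  toggle p (ideal_of_syt T) = ideal_of_syt T.
Proof.
case: toggleP => // J flipJ; case/negP.
have [T' /eqP def_J] := ideal_of_syt_surj J; rewrite -def_J in flipJ.
have [i swap_p] := swappable_of_flip flipJ.
by rewrite -(swappable_level swap_p).
Qed.

Lemma pro_c_ideal_of_syt T t :
  t.+1 < n + m -> pro_c t (ideal_of_syt T) = ideal_of_syt (rho t.+1 T).
Proof.
move=> t_range; rewrite /pro_c; set s := filter _ _.
have level_s q : (q \in s) = (int_a q + int_b q == t).
  by rewrite mem_filter mem_enum andbT.
have s_fixed U q : q \in s -> ~~ swappable t.+1 U q ->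
    toggle q (ideal_of_syt U) = ideal_of_syt U.
  by rewrite level_s => /eqP <-; apply: toggle_unswappable.
have [p swap_p|unswappable] := pickP (swappable t.+1 T).
  have p_s : p \in s by rewrite level_s; have [<-] := swappable_level swap_p.
  have toggle_p : toggle p (ideal_of_syt T) = ideal_of_syt (rho t.+1 T).
    exact: toggle_swappable.
  rewrite -toggle_p.
  apply: foldr_single_mover; rewrite ?toggle_p ?filter_uniq -?enumT ?enum_uniq //.
  - move=> q q_s ne_qp; apply: s_fixed => //; apply: contra ne_qp => swap_q.
    exact/eqP/(swappable_inj swap_q).
  - move=> q q_s ne_qp; apply: s_fixed => //; apply: contra ne_qp.
    by rewrite swappable_rho // => swap_q; apply/eqP/(swappable_inj swap_q).
rewrite foldr_fixed => [|q q_s]; last by rewrite s_fixed ?unswappable.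
by apply: ideal_inj => q; rewrite mem_ideal_of_rho // unswappable addbF.
Qed.

Lemma pro_ideal_of_syt T : pro (ideal_of_syt T) = ideal_of_syt (Pro T).
Proof.
rewrite /pro /Pro skew_size_two_row // (iotaDl 1 0).
have : {in iota 0 (n + m).-1, forall t, t.+1 < n + m}.
  by move=> t; rewrite mem_iota; lia.
elim: (iota 0 _) T => //= t s IHs T s_range.
rewrite pro_c_ideal_of_syt ?s_range ?mem_head // IHs // => u us.
by rewrite s_range // inE us orbT.
Qed.

End TwoRow.

Theorem theorem4p12 (n k m : nat) (hm : m <= n + k) :
  exists Phi : ideal (Int n k m) -> syt [:: n + k; m] [:: k],
    bijective Phi /\ Phi \o @pro n k m =1 @Pro [:: n + k; m] [:: k] \o Phi.
Proof.
have [Phi sytK PhiK] := ideal_of_syt_bij hm.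
exists Phi; split; first by exists (ideal_of_syt hm).
by move=> I /=; rewrite -{1}[I]PhiK pro_ideal_of_syt sytK.
Qed.
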